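(* Let $\mathcal{P} \subseteq \mathbb{C}^{n_p}$, let $\mu$ be a measure over $\mathcal{P}$, let $H \in L_2(\mathcal{P}, \mu; \mathbb{C}^{n_o \times n_i})$, and let $\hat\alpha_i, \hat\beta_j, \hat\gamma_k \colon \mathcal{P} \to \mathbb{C}$ ($i = 1, \dots, q_A$; $j = 1, \dots, q_B$; $k = 1, \dots, q_C$) be measurable functions satisfying $$\int_{\mathcal{P}} \left( \frac{\sum_{j=1}^{q_B} |\hat\beta_j(p)| \, \sum_{k=1}^{q_C} |\hat\gamma_k(p)|}{\sum_{i=1}^{q_A} |\hat\alpha_i(p)|} \right)^{2} d\mu(p) < \infty .$$ Let $\Sigma_{\mathrm{St}}$ be the set of all tuples $(\hat A_i, \hat B_j, \hat C_k)$ with $\hat A_i \in \mathbb{C}^{r \times r}$, $\hat B_j \in \mathbb{C}^{r \times n_i}$, $\hat C_k \in \mathbb{C}^{n_o \times r}$ such that $\operatorname{ess\,sup}_{p \in \mathcal{P}} \| \hat\alpha_i(p) \hat{\mathcal{A}}(p)^{-1} \|_F < \infty$ for $i = 1, \dots, q_A$, and let $\Sigma_{\mathrm{D\text{-}St}}$ be the set of those tuples in $\Sigma_{\mathrm{St}}$ for which all $\hat A_i$ are diagonal. Let $(\hat A_i, \hat B_j, \hat C_k)$ be $L_2$-optimal for $H$ among $\Sigma_{\mathrm{D\text{-}St}}$. Then, for $\ell = 1, 2, \dots, r$, $$\int_{\mathcal{P}} \frac{\overline{\hat\gamma_k(p)} \, H(p) b_\ell(p)}{\overline{a_\ell(p)}}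 \, d\mu(p) = \int_{\mathcal{P}} \frac{\overline{\hat\gamma_k(p)} \, \hat H(p) b_\ell(p)}{\overline{a_\ell(p)}} \, d\mu(p), \quad k = 1, \dots, q_C,$$ $$\int_{\mathcal{P}} \frac{\overline{\hat\beta_j(p)} \, c_\ell(p)^* H(p)}{\overline{a_\ell(p)}} \, d\mu(p) = \int_{\mathcal{P}} \frac{\overline{\hat\beta_j(p)} \, c_\ell(p)^* \hat H(p)}{\overline{a_\ell(p)}} \, d\mu(p), \quad j = 1, \dots, q_B,$$ $$\int_{\mathcal{P}} \frac{\overline{\hat\alpha_i(p)} \, c_\ell(p)^* H(p) b_\ell(p)}{\overline{a_\ell(p)}^{2}} \, d\mu(p) = \int_{\mathcal{P}} \frac{\overline{\hat\alpha_i(p)} \, c_\ell(p)^* \hat H(p) b_\ell(p)}{\overline{a_\ell(p)}^{2}} \, d\mu(p), \quad i = 1, \dots, q_A.$$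
   Context: $n_p, n_o, n_i, r, q_A, q_B, q_C$ are positive integers; $(\cdot)^*$ is the conjugate transpose and $\|\cdot\|_F$ the Frobenius norm. For a tuple $(\hat A_i, \hat B_j, \hat C_k)$ (a structured reduced-order model) define $$\hat{\mathcal{A}}(p) = \sum_{i=1}^{q_A} \hat\alpha_i(p) \hat A_i, \quad \hat{\mathcal{B}}(p) = \sum_{j=1}^{q_B} \hat\beta_j(p) \hat B_j, \quad \hat{\mathcal{C}}(p) = \sum_{k=1}^{q_C} \hat\gamma_k(p) \hat C_k, \quad \hat H(p) = \hat{\mathcal{C}}(p) \hat{\mathcal{A}}(p)^{-1} \hat{\mathcal{B}}(p).$$ When all $\hat A_i$ are diagonal, $a_\ell(p)$ denotes the $\ell$th diagonal entry of $\hat{\mathcal{A}}(p)$, $b_\ell(p) \in \mathbb{C}^{n_i}$ the $\ell$th column of $\hat{\mathcal{B}}(p)^*$, and $c_\ell(p) \in \mathbb{C}^{n_o}$ the $\ell$th column of $\hat{\mathcal{C}}(p)$, so that $\hat H(p) = \sum_{\ell=1}^{r} c_\ell(p) b_\ell(p)^* / a_\ell(p)$. A tuple is $L_2$-optimal for $H$ among a set of tuples if it minimizes $\mathcal{J}(\hat A_i, \hat B_j, \hat C_k) = \int_{\mathcal{P}} \| H(p) - \hat H(p) \|_F^2 \, d\mu(p)$ over that set. *)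

(* Defs.v *)
From HB Require Import structures.
From mathcomp Require Import all_boot all_order all_algebra.
From mathcomp Require Import spectral.
From mathcomp Require Import all_classical all_reals all_analysis.
From mathcomp Require Import ess_sup_inf complex.

Set Implicit Arguments.
Unset Strict Implicit.
Unset Printing Implicit Defensive.

Import Order.TTheory GRing.Theory Num.Theory.
Import numFieldNormedType.Exports.

Local Open Scope classical_set_scope.
Local Open Scope ring_scope.
Local Open Scope sesquilinear_scope.

(* Sigma-algebras can only be put on pointed types; this makes R[i], hence
   'cV[R[i]]_n, a pointed type. *)
HB.instance Definition _ (R : realType) := isPointed.Build R[i] 0.

(* The R-valued modulus (`|z| itself is R[i]-valued). *)
Definition cabs (R : realType) (z : R[i]) : R := ComplexField.Normc.normc z.

Definition frobenius (R : realType) m n (M : 'M[R[i]]_(m, n)) : R :=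
  Num.sqrt (\sum_(i < m) \sum_(j < n) cabs (M i j) ^+ 2).

(* The libraries have neither measurability nor integrals for complex-valued
   functions: both are taken on real and imaginary parts, and matrix-valued
   functions are treated entrywise. *)
Section ComplexIntegration.
Context d (T : measurableType d) (R : realType).
Variables (mu : {measure set T -> \bar R}) (D : set T).

Definition cmeasurable (f : T -> R[i]) : Prop :=
  measurable_fun D (fun x => complex.Re (f x)) /\
  measurable_fun D (fun x => complex.Im (f x)).

Definition cintegrable (f : T -> R[i]) : Prop :=
  mu.-integrable D (fun x => (complex.Re (f x))%:E) /\
  mu.-integrable D (fun x => (complex.Im (f x))%:E).

Definition cintegral (f : T -> R[i]) : R[i] :=
  Complex (\int[mu]_(x in D) complex.Re (f x))
          (\int[mu]_(x in D) complex.Im (f x)).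

Definition mx_integrable m n (F : T -> 'M[R[i]]_(m, n)) : Prop :=
  forall i j, cintegrable (fun x => F x i j).

Definition mx_integral m n (F : T -> 'M[R[i]]_(m, n)) : 'M[R[i]]_(m, n) :=
  \matrix_(i, j) cintegral (fun x => F x i j).

(* "\int F = \int G", including that both integrals exist: cintegral takes
   default values on functions that are not integrable. *)
Definition eq_mx_integral m n (F G : T -> 'M[R[i]]_(m, n)) : Prop :=
  [/\ mx_integrable F, mx_integrable G & mx_integral F = mx_integral G].

Definition mx_L2 m n (F : T -> 'M[R[i]]_(m, n)) : Prop :=
  (forall i j, cmeasurable (fun x => F x i j)) /\
  (\int[mu]_(x in D) (frobenius (F x) ^+ 2)%:E < +oo)%E.

End ComplexIntegration.

Record structured_rom (R : realType) (no ni r qA qB qC : nat) := StructuredRom {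
  romA : 'I_qA -> 'M[R[i]]_r ;
  romB : 'I_qB -> 'M[R[i]]_(r, ni) ;
  romC : 'I_qC -> 'M[R[i]]_(no, r) }.

Section StructuredRom.
Context (T : Type) (R : realType) (no ni r qA qB qC : nat).
Variables (alpha : 'I_qA -> T -> R[i]) (beta : 'I_qB -> T -> R[i])
          (gamma : 'I_qC -> T -> R[i]).
Implicit Type S : structured_rom R no ni r qA qB qC.

Definition calA S (p : T) : 'M[R[i]]_r := \sum_i alpha i p *: romA S i.
Definition calB S (p : T) : 'M[R[i]]_(r, ni) := \sum_j beta j p *: romB S j.
Definition calC S (p : T) : 'M[R[i]]_(no, r) := \sum_k gamma k p *: romC S k.

Definition Hhat S (p : T) : 'M[R[i]]_(no, ni) :=
  calC S p *m invmx (calA S p) *m calB S p.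

Definition diag_a S (l : 'I_r) (p : T) : R[i] := calA S p l l.
Definition col_b S (l : 'I_r) (p : T) : 'cV[R[i]]_ni := col l ((calB S p)^t*).
Definition col_c S (l : 'I_r) (p : T) : 'cV[R[i]]_no := col l (calC S p).

End StructuredRom.

Section Optimality.
Context d (T : measurableType d) (R : realType) (no ni r qA qB qC : nat).
Variables (mu : {measure set T -> \bar R}) (P : set T) (mP : measurable P).
Variables (alpha : 'I_qA -> T -> R[i]) (beta : 'I_qB -> T -> R[i])
          (gamma : 'I_qC -> T -> R[i]).

Local Notation rom := (structured_rom R no ni r qA qB qC).

(* The inverse in the essential supremum has to exist for almost every p;
   this is stated separately because invmx M = M when M is singular.
   mrestr mu mP is mu restricted to P. *)
Definition Sigma_St : set rom := [set S |
  {ae mu, forall p, P p -> calA alpha S p \in unitmx} /\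
  forall i : 'I_qA,
    (ess_sup (mrestr mu mP)
       (fun p => (frobenius (alpha i p *: invmx (calA alpha S p)))%:E)
     < +oo)%E].

Definition Sigma_DSt : set rom :=
  [set S | Sigma_St S /\ forall i : 'I_qA, is_diag_mx (romA S i)].

Definition L2_cost (H : T -> 'M[R[i]]_(no, ni)) (S : rom) : \bar R :=
  (\int[mu]_(p in P) (frobenius (H p - Hhat alpha beta gamma S p) ^+ 2)%:E)%E.

Definition L2_optimal (H : T -> 'M[R[i]]_(no, ni)) (Sigma : set rom) (S : rom)
    : Prop :=
  Sigma S /\ forall S', Sigma S' -> (L2_cost H S <= L2_cost H S')%E.

End Optimality.

(* Main.v *)
Require Import Defs.
From HB Require Import structures.
From mathcomp Require Import all_boot all_order all_algebra.
From mathcomp Require Import spectral.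
From mathcomp Require Import all_classical all_reals all_analysis.
From mathcomp Require Import complex.
From mathcomp Require Import measurable_realfun ess_sup_inf.
From mathcomp Require Import ring lra.

Set Implicit Arguments.
Unset Strict Implicit.
Unset Printing Implicit Defensive.

Import Order.TTheory GRing.Theory Num.Theory.
Import numFieldNormedType.Exports.

Local Open Scope classical_set_scope.
Local Open Scope ring_scope.
Local Open Scope sesquilinear_scope.

(** The cost is quadratic in the error, so optimality can be tested entry by
    entry. Move a single entry of one coefficient matrix of the optimal model
    by a small complex multiple [t] of a unit. If the new model is still
    admissible and its transfer function is [Hhat + t w V], with [V] square
    integrable and [w = 1 + O(t)] uniformly in [p], then
      [cost (Hhat + t w V)
         <= cost Hhat - 2 Re (conj t * <V, H - Hhat>) + O(|t|^2)],
    and minimality for all small complex [t] forces [<V, H - Hhat> = 0]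
    ([first_variation], [optimal_stationary]). The three families of identities
    are this orthogonality for three choices of [V]:
    - an entry of [C_k]: [V] is [gamma_k b_l^* / a_l] in one row, with [w = 1];
    - an entry of [B_j]: [V] is [beta_j c_l / a_l] in one column, with [w = 1];
    - the [l]-th diagonal entry of [A_i]: subtracting [t] turns [1 / a_l] into
      [1 / (a_l - t alpha_i)], whence [V = alpha_i c_l b_l^* / a_l^2] and
      [w = a_l / (a_l - t alpha_i)].

    For diagonal models the essential-supremum condition says that
    [|alpha_i| <= K |a_l|] almost everywhere, for some constant [K] and all
    [i], [l], with no [a_l] vanishing ([Sigma_DStP]). This gives everything
    that the argument needs. It survives a small change of a diagonal entry of
    [A_i], with [2 K] in place of [K], which is the admissibility of the
    perturbed model; it bounds [w - 1] by [2 K |t|]; and, summed over [i], it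
    bounds [1 / |a_l|] by a multiple of [1 / sum_i |alpha_i|], so that the
    integrability assumption on the coefficient functions puts [Hhat] and all
    three [V] in L2 ([square_integrable_term]). *)

(** * The modulus and the parts of a complex number *)

Section Modulus.
Context (R : realType).
Implicit Types z w : R[i].

Lemma cabs_ge0 z : 0 <= cabs z.
Proof. by case: z => a b; exact: sqrtr_ge0. Qed.

Lemma sqr_cabs z : cabs z ^+ 2 = complex.Re z ^+ 2 + complex.Im z ^+ 2.
Proof. by case: z => a b /=; rewrite sqr_sqrtr// addr_ge0// sqr_ge0. Qed.

Lemma cabs0 : cabs (0 : R[i]) = 0. Proof. exact: ComplexField.Normc.normc0. Qed.

Lemma cabsM z w : cabs (z * w) = cabs z * cabs w.
Proof. exact: ComplexField.Normc.normcM. Qed.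

Lemma cabsV z : cabs z^-1 = (cabs z)^-1.
Proof. exact: ComplexField.Normc.normcV. Qed.

Lemma cabsD z w : cabs (z + w) <= cabs z + cabs w.
Proof. exact: le_normcD. Qed.

Lemma cabsN z : cabs (- z) = cabs z. Proof. exact: normcN. Qed.

Lemma cabsJ z : cabs z^* = cabs z.
Proof. by case: z => a b; rewrite /cabs /= sqrrN. Qed.

Lemma cabs_eq0 z : (cabs z == 0) = (z == 0).
Proof.
apply/eqP/eqP => [/ComplexField.Normc.eq0_normc//|->]; exact: cabs0.
Qed.

Lemma cabs_sum (I : finType) (F : I -> R[i]) :
  cabs (\sum_i F i) <= \sum_i cabs (F i).
Proof.
apply: (big_ind2 (fun z x => cabs z <= x)) => //; first by rewrite cabs0.
by move=> z x w y zx wy; apply: le_trans (lerD zx wy); exact: cabsD.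
Qed.

Lemma cabs_natb (b : bool) : cabs (b%:R : R[i]) <= 1.
Proof. by case: b; rewrite ?cabs0// /cabs ComplexField.Normc.normc1. Qed.

Lemma cabs_le_sum q (x : 'I_q -> R[i]) k : cabs (x k) <= \sum_i cabs (x i).
Proof. by rewrite (bigD1 k)//= lerDl sumr_ge0// => ? _; exact: cabs_ge0. Qed.

Lemma normr_Re_le z : `|complex.Re z| <= cabs z.
Proof.
rewrite -ler_sqr ?nnegrE ?cabs_ge0// sqr_cabs real_normK ?num_real//.
by rewrite lerDl sqr_ge0.
Qed.

Lemma normr_Im_le z : `|complex.Im z| <= cabs z.
Proof.
rewrite -ler_sqr ?nnegrE ?cabs_ge0// sqr_cabs real_normK ?num_real//.
by rewrite lerDr sqr_ge0.
Qed.

Lemma complex_ReM z w : complex.Re (z * w) =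
  complex.Re z * complex.Re w - complex.Im z * complex.Im w.
Proof. by case: z w => a b [c e]. Qed.

Lemma complex_ImM z w : complex.Im (z * w) =
  complex.Re z * complex.Im w + complex.Im z * complex.Re w.
Proof. by case: z w => a b [c e]. Qed.

Lemma complex_ReN z : complex.Re (- z) = - complex.Re z. Proof. by case: z. Qed.

Lemma complex_ReD z w : complex.Re (z + w) = complex.Re z + complex.Re w.
Proof. by case: z w => a b [c e]. Qed.

Lemma complex_Re_sum (I : finType) (F : I -> R[i]) :
  complex.Re (\sum_i F i) = \sum_i complex.Re (F i).
Proof. exact: (big_morph _ complex_ReD). Qed.

Lemma complex_ImD z w : complex.Im (z + w) = complex.Im z + complex.Im w.
Proof. by case: z w => a b [c e]. Qed.

Lemma complex_ReJ z : complex.Re z^* = complex.Re z. Proof. by case: z. Qed.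

Lemma complex_ImJ z : complex.Im z^* = - complex.Im z. Proof. by case: z. Qed.

Lemma complex_ReV z : complex.Re z^-1 =
  complex.Re z * (complex.Re z ^+ 2 + complex.Im z ^+ 2)^-1.
Proof. by case: z. Qed.

Lemma complex_ImV z : complex.Im z^-1 =
  - (complex.Im z * (complex.Re z ^+ 2 + complex.Im z ^+ 2)^-1).
Proof. by case: z. Qed.

End Modulus.

(** * Measurability of complex-valued functions *)

Section ComplexMeasurability.
Context d (T : measurableType d) (R : realType) (D : set T).
Implicit Types f g : T -> R[i].

Lemma cmeasurable_cst (z : R[i]) : cmeasurable D (fun=> z : R[i]).
Proof. by split; exact: measurable_cst. Qed.

Lemma cmeasurableD f g :
  cmeasurable D f -> cmeasurable D g -> cmeasurable D (fun x => f x + g x).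
Proof.
move=> [f1 f2] [g1 g2]; split.
  by under eq_fun do rewrite complex_ReD; exact: measurable_funD.
by under eq_fun do rewrite complex_ImD; exact: measurable_funD.
Qed.

Lemma cmeasurableM f g :
  cmeasurable D f -> cmeasurable D g -> cmeasurable D (fun x => f x * g x).
Proof.
move=> [f1 f2] [g1 g2]; split.
  by under eq_fun do rewrite complex_ReM;
    apply: measurable_funB; exact: measurable_funM.
by under eq_fun do rewrite complex_ImM;
  apply: measurable_funD; exact: measurable_funM.
Qed.

Lemma cmeasurableN f : cmeasurable D f -> cmeasurable D (fun x => - f x).
Proof.
move=> mf; under eq_fun do rewrite -mulN1r.
by apply: cmeasurableM => //; exact: cmeasurable_cst.
Qed.

Lemma cmeasurableB f g :
  cmeasurable D f -> cmeasurable D g -> cmeasurable D (fun x => f x - g x).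
Proof. by move=> mf mg; apply: cmeasurableD => //; exact: cmeasurableN. Qed.

Lemma cmeasurableJ f : cmeasurable D f -> cmeasurable D (fun x => (f x)^*).
Proof.
move=> [f1 f2]; split; first by under eq_fun do rewrite complex_ReJ.
by under eq_fun do rewrite complex_ImJ; exact: measurable_funN.
Qed.

Lemma cmeasurable_sum (I : finType) (h : I -> T -> R[i]) :
  (forall i, cmeasurable D (h i)) -> cmeasurable D (fun x => \sum_i h i x).
Proof.
move=> mh; elim: (index_enum I) => [|i s IHs].
  by under eq_fun do rewrite big_nil; exact: cmeasurable_cst.
by under eq_fun do rewrite big_cons; exact: cmeasurableD.
Qed.

Lemma cmeasurable_prod (I : finType) (h : I -> T -> R[i]) :
  (forall i, cmeasurable D (h i)) -> cmeasurable D (fun x => \prod_i h i x).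
Proof.
move=> mh; elim: (index_enum I) => [|i s IHs].
  by under eq_fun do rewrite big_nil; exact: cmeasurable_cst.
by under eq_fun do rewrite big_cons; exact: cmeasurableM.
Qed.

Lemma measurable_sqr_cabs f : cmeasurable D f ->
  measurable_fun D (fun x => cabs (f x) ^+ 2).
Proof.
move=> [f1 f2]; under eq_fun do rewrite sqr_cabs.
by apply: measurable_funD; exact: measurable_funX.
Qed.

(** Inversion of a nonnegative real is the real power of exponent -1, which is
    measurable; the value at 0 agrees since both conventions give 0. *)
Lemma measurable_fun_inv_ge0 (f : T -> R) : (forall x, 0 <= f x) ->
  measurable_fun D f -> measurable_fun D (fun x => (f x)^-1).
Proof.
move=> f0 mf; under eq_fun do rewrite -powR_inv1//.
by apply: (measurableT_comp (f := (@powR R ^~ (-1)))) => //;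
  exact: measurable_powR.
Qed.

Lemma measurable_cabs f : cmeasurable D f ->
  measurable_fun D (fun x => cabs (f x)).
Proof.
move=> /measurable_sqr_cabs mf.
have -> : (fun x => cabs (f x)) = (fun x => (cabs (f x) ^+ 2) `^ 2^-1).
  apply/funext => x; rewrite powR12_sqrt ?sqr_ge0// sqrtr_sqr.
  by rewrite ger0_norm ?cabs_ge0.
by apply: (measurableT_comp (f := (@powR R ^~ 2^-1))) => //;
  exact: measurable_powR.
Qed.

Lemma cmeasurableV f : cmeasurable D f -> cmeasurable D (fun x => (f x)^-1).
Proof.
move=> mf; have [f1 f2] := mf.
have mi : measurable_fun D (fun x => (cabs (f x) ^+ 2)^-1).
  apply: measurable_fun_inv_ge0; last exact: measurable_sqr_cabs.
  by move=> x; exact: sqr_ge0.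
split.
  by under eq_fun do rewrite complex_ReV -sqr_cabs; exact: measurable_funM.
under eq_fun do rewrite complex_ImV -sqr_cabs.
by apply: measurable_funN; exact: measurable_funM.
Qed.

Lemma cmeasurable_det n (A : T -> 'M[R[i]]_n) :
  (forall i j, cmeasurable D (fun x => A x i j)) ->
  cmeasurable D (fun x => \det (A x)).
Proof.
move=> mA; apply: cmeasurable_sum => s; apply: cmeasurableM.
  exact: cmeasurable_cst.
by apply: cmeasurable_prod => i; exact: mA.
Qed.

(** The convention [invmx M = M] for singular [M] forces a case distinction,
    which [x * x^-1], being 1 or 0 according to whether [x] vanishes, performs
    inside the algebra of measurable functions. *)
Lemma cmeasurable_invmx n (A : T -> 'M[R[i]]_n) :
  (forall i j, cmeasurable D (fun x => A x i j)) ->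
  forall i j, cmeasurable D (fun x => invmx (A x) i j).
Proof.
move=> mA i j; pose u x := \det (A x) * (\det (A x))^-1.
have mdet := cmeasurable_det mA.
have mes_u : cmeasurable D u.
  by apply: cmeasurableM => //; exact: cmeasurableV.
have -> : (fun x => invmx (A x) i j) = (fun x =>
    u x * ((\det (A x))^-1 * \adj (A x) i j) + (1 - u x) * A x i j).
  apply/funext => x; rewrite /u /invmx unitmxE unitfE.
  case: eqVneq => [->|d0]; first by rewrite mul0r subr0 mul0r mul1r add0r.
  by rewrite divff// subrr mul0r addr0 mul1r mxE.
apply: cmeasurableD; apply: cmeasurableM => //.
- apply: cmeasurableM; first exact: cmeasurableV.
  under eq_fun do rewrite mxE.
  apply: cmeasurableM; first exact: cmeasurable_cst.
  apply: cmeasurable_det => k l.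
  by under eq_fun do rewrite !mxE; exact: mA.
- by apply: cmeasurableB => //; exact: cmeasurable_cst.
Qed.

Lemma cmeasurable_mulmx m n p (A : T -> 'M[R[i]]_(m, n))
    (B : T -> 'M[R[i]]_(n, p)) :
  (forall i j, cmeasurable D (fun x => A x i j)) ->
  (forall i j, cmeasurable D (fun x => B x i j)) ->
  forall i j, cmeasurable D (fun x => (A x *m B x) i j).
Proof.
move=> mA mB i j; under eq_fun do rewrite mxE.
by apply: cmeasurable_sum => k; exact: cmeasurableM.
Qed.

End ComplexMeasurability.

(** * Square-integrable complex functions *)

Section SquareIntegrable.
Context d (T : measurableType d) (R : realType).
Variables (mu : {measure set T -> \bar R}) (D : set T) (mD : measurable D).

(** Replacing [g - f] by its positive part changes it on a null set only, and
    the positive part has a nonnegative integral. *)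
Lemma ae_le_Rintegral (f g : T -> R) :
  mu.-integrable D (EFin \o f) -> mu.-integrable D (EFin \o g) ->
  {ae mu, forall x, D x -> f x <= g x} ->
  \int[mu]_(x in D) f x <= \int[mu]_(x in D) g x.
Proof.
move=> fi gi fg.
have hi : mu.-integrable D (EFin \o (fun x => Num.max (g x - f x) 0)).
  have gfi := integrableB mD gi fi.
  apply: le_integrable gfi => //.
    apply/measurable_EFinP; apply: measurable_maxr => //.
    by apply: measurable_funB; apply/measurable_EFinP; exact: (measurable_int mu).
  move=> x _ /=; rewrite lee_fin ger0_norm ?le_max ?lexx ?orbT//.
  by rewrite ge_max ler_norm normr_ge0.
have gfh : \int[mu]_(x in D) (g x - f x) =
           \int[mu]_(x in D) Num.max (g x - f x) 0.
  congr fine; apply: ae_eq_integral => //.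
  - exact: (measurable_int mu (integrableB mD gi fi)).
  - exact: (measurable_int mu hi).
  - apply: filterS fg => x fgx Dx; congr EFin.
    by rewrite max_l// subr_ge0 fgx.
rewrite -subr_ge0 -RintegralB// gfh; apply: Rintegral_ge0 => x _.
by rewrite le_max lexx orbT.
Qed.

Lemma ae_le_integrable (f g : T -> R) : measurable_fun D f ->
  mu.-integrable D (EFin \o g) ->
  {ae mu, forall x, D x -> `|f x| <= g x} ->
  mu.-integrable D (EFin \o f).
Proof.
move=> mf gi fg; have /integrableP[mg goo] := gi.
apply/integrableP; split; first exact/measurable_EFinP.
apply: le_lt_trans goo; apply: ae_ge0_le_integral => //.
- by apply: measurableT_comp => //; exact/measurable_EFinP.
- exact: measurableT_comp.
- apply: filterS fg => x fgx Dx /=; rewrite lee_fin.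
  by rewrite (le_trans (fgx Dx))// ler_norm.
Qed.

Lemma ae_le_cintegrable (f : T -> R[i]) (g : T -> R) : cmeasurable D f ->
  mu.-integrable D (EFin \o g) ->
  {ae mu, forall x, D x -> cabs (f x) <= g x} -> cintegrable mu D f.
Proof.
move=> [f1 f2] gi fg; split; apply: (ae_le_integrable _ gi) => //;
  apply: filterS fg => x fgx Dx; apply: le_trans (fgx Dx).
- exact: normr_Re_le.
- exact: normr_Im_le.
Qed.

Lemma cintegrable_sum (I : finType) (h : I -> T -> R[i]) :
  (forall i, cintegrable mu D (h i)) ->
  cintegrable mu D (fun x => \sum_i h i x).
Proof.
move=> hi; elim: (index_enum I) => [|i s [IH1 IH2]].
  under eq_fun do rewrite big_nil.
  by split; exact: integrable0.
have [h1 h2] := hi i.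
under eq_fun do rewrite big_cons; split.
  under eq_fun do rewrite complex_ReD EFinD; exact: integrableD.
under eq_fun do rewrite complex_ImD EFinD; exact: integrableD.
Qed.

Lemma cintegralB (f g : T -> R[i]) : cintegrable mu D f ->
  cintegrable mu D g ->
  cintegral mu D (fun x => f x - g x) = cintegral mu D f - cintegral mu D g.
Proof.
move=> [f1 f2] [g1 g2]; rewrite /cintegral -[RHS]/(Complex _ _).
have ReB (z w : R[i]) : complex.Re (z - w) = complex.Re z - complex.Re w.
  by case: z w => ? ? [].
have ImB (z w : R[i]) : complex.Im (z - w) = complex.Im z - complex.Im w.
  by case: z w => ? ? [].
congr Complex; rewrite -RintegralB//; apply: eq_Rintegral => x _.
  exact: ReB.
exact: ImB.
Qed.

Definition square_integrable (f : T -> R[i]) : Prop :=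
  cmeasurable D f /\ mu.-integrable D (EFin \o (fun x => cabs (f x) ^+ 2)).

Lemma square_integrable_dominated (f : T -> R[i]) (g : T -> R) (K : R) :
  cmeasurable D f -> mu.-integrable D (EFin \o (fun x => g x ^+ 2)) ->
  {ae mu, forall x, D x -> cabs (f x) <= K * g x} -> square_integrable f.
Proof.
move=> mf gi fg; split=> //.
apply: (ae_le_integrable (g := fun x => K ^+ 2 * g x ^+ 2)).
- exact: measurable_sqr_cabs.
- by under [_ \o _]eq_fun do rewrite /= EFinM; exact: integrableZl.
- apply: filterS fg => x fgx Dx.
  rewrite ger0_norm ?sqr_ge0// -exprMn ler_sqr ?nnegrE ?fgx ?cabs_ge0//.
  by rewrite (le_trans _ (fgx Dx))// cabs_ge0.
Qed.

Lemma square_integrableD (f g : T -> R[i]) : square_integrable f ->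
  square_integrable g -> square_integrable (fun x => f x + g x).
Proof.
move=> [mf fi] [mg gi]; split; first exact: cmeasurableD.
apply: (ae_le_integrable
  (g := fun x => (cabs (f x) ^+ 2 + cabs (g x) ^+ 2) *+ 2)).
- by apply: measurable_sqr_cabs; exact: cmeasurableD.
- under [_ \o _]eq_fun do rewrite /= mulr2n EFinD EFinD.
  have := integrableD mD fi gi => fgi; exact: (integrableD mD fgi fgi).
- apply: aeW => x _; rewrite ger0_norm ?sqr_ge0//.
  apply: (@le_trans _ _ ((cabs (f x) + cabs (g x)) ^+ 2)).
    by rewrite ler_sqr ?nnegrE ?addr_ge0 ?cabs_ge0 ?cabsD.
  by have := sqr_ge0 (cabs (f x) - cabs (g x)); rewrite sqrrB sqrrD; lra.
Qed.

Lemma square_integrableB (f g : T -> R[i]) : square_integrable f ->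
  square_integrable g -> square_integrable (fun x => f x - g x).
Proof.
move=> fi [mg gi]; apply: square_integrableD => //; split.
  exact: cmeasurableN.
by under [_ \o _]eq_fun do rewrite /= cabsN.
Qed.

Lemma square_integrable_sum (I : finType) (h : I -> T -> R[i]) :
  (forall i, square_integrable (h i)) ->
  square_integrable (fun x => \sum_i h i x).
Proof.
move=> hi; elim: (index_enum I) => [|i s IH].
  under eq_fun do rewrite big_nil.
  split; first exact: cmeasurable_cst.
  suff -> : EFin \o (fun=> cabs (0 : R[i]) ^+ 2) = cst (0 : \bar R) :> (T -> _).
    exact: integrable0.
  by apply/funext => x; rewrite [LHS]/comp cabs0 expr0n.
by under eq_fun do rewrite big_cons; exact: square_integrableD.
Qed.

Lemma square_integrableM_bounded (f g : T -> R[i]) (K : R) :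
  cmeasurable D f -> {ae mu, forall x, D x -> cabs (f x) <= K} ->
  square_integrable g -> square_integrable (fun x => f x * g x).
Proof.
move=> mf fK [mg gi].
apply: (square_integrable_dominated (K := K) (cmeasurableM mf mg) gi).
by apply: filterS fK => x fK Dx; rewrite cabsM ler_wpM2r ?cabs_ge0// fK.
Qed.

(** By [2 |f g| <= |f|^2 + |g|^2]. *)
Lemma square_integrable_cintegrableM (f g : T -> R[i]) :
  square_integrable f -> square_integrable g ->
  cintegrable mu D (fun x => f x * g x).
Proof.
move=> [mf fi] [mg gi].
apply: (ae_le_cintegrable (g := fun x => cabs (f x) ^+ 2 + cabs (g x) ^+ 2)).
- exact: cmeasurableM.
- by under [_ \o _]eq_fun do rewrite /= EFinD; exact: integrableD.
- apply: aeW => x _; rewrite cabsM.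
  move: (cabs (f x)) (cabs (g x)) => a b.
  have := sqr_ge0 (a - b); have := sqr_ge0 (a + b); nra.
Qed.

Lemma square_integrableJ f : square_integrable f ->
  square_integrable (fun x => (f x)^*).
Proof.
move=> [mf fi]; split; first exact: cmeasurableJ.
by under [_ \o _]eq_fun do rewrite /= cabsJ.
Qed.

End SquareIntegrable.

(** * The first-order condition for the squared distance *)

Lemma sqr_frobenius (R : realType) m n (M : 'M[R[i]]_(m, n)) :
  frobenius M ^+ 2 = \sum_i \sum_j cabs (M i j) ^+ 2.
Proof.
by rewrite sqr_sqrtr//; do 2 (apply: sumr_ge0 => ? _); exact: sqr_ge0.
Qed.

Lemma cabs_le_frobenius (R : realType) m n (M : 'M[R[i]]_(m, n)) i j :
  cabs (M i j) <= frobenius M.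
Proof.
rewrite -ler_sqr ?nnegrE ?cabs_ge0 ?sqrtr_ge0// sqr_frobenius.
rewrite (bigD1 i)//= (bigD1 j)//= -addrA lerDl addr_ge0//.
  by apply: sumr_ge0 => k _; exact: sqr_ge0.
by do 2 (apply: sumr_ge0 => ? _); exact: sqr_ge0.
Qed.

(** The expansion [|x - z|^2 = |x|^2 - 2 Re (conj z * x) + |z|^2] at
    [z = t w y], with [w] replaced by [1] in the linear term. The replacement
    costs [2 |t| |w - 1| |x| |y|], which is at most
    [L |t|^2 (|x|^2 + |y|^2)]; so the remainder is [|t|^2] times a quantity
    that is integrable as soon as [x] and [y] are square integrable. *)
Lemma sqr_cabs_first_order (R : realType) (L delta : R) (t w x y : R[i]) :
  0 <= L -> cabs t <= delta -> cabs (w - 1) <= L * cabs t ->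
  cabs (x - t * w * y) ^+ 2 <=
    cabs x ^+ 2 - complex.Re (t^* * (y^* * x)) *+ 2 +
    cabs t ^+ 2 * (L * (cabs x ^+ 2 + cabs y ^+ 2) +
                   (1 + L * delta) ^+ 2 * cabs y ^+ 2).
Proof.
move=> L0 td wL; have t0 := cabs_ge0 t.
have w1 : cabs w <= 1 + L * delta.
  rewrite -[w in cabs w](subrK 1) addrC; apply: le_trans (cabsD _ _) _.
  rewrite {1}/cabs ComplexField.Normc.normc1 lerD2l (le_trans wL)//.
  exact: ler_wpM2l.
have polar (z : R[i]) : cabs (x - z) ^+ 2 =
    cabs x ^+ 2 - complex.Re (z^* * x) *+ 2 + cabs z ^+ 2.
  rewrite !sqr_cabs; case: x z => a b [c e] /=; ring.
rewrite polar.
have -> : complex.Re ((t * w * y)^* * x) =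
    complex.Re (t^* * (y^* * x)) + complex.Re ((t * (w - 1) * y)^* * x).
  by case: t w x y {t0 td wL w1 polar} => [t1 t2] [w1 w2] [x1 x2] [y1 y2] /=; ring.
have : - complex.Re ((t * (w - 1) * y)^* * x) *+ 2 <=
    cabs t ^+ 2 * (L * (cabs x ^+ 2 + cabs y ^+ 2)).
  apply: (@le_trans _ _ (cabs ((t * (w - 1) * y)^* * x) *+ 2)).
    rewrite lerMn2r /= -complex_ReN.
    rewrite complex_ReN; apply: le_trans (normr_Re_le _).
    by rewrite -normrN ler_norm.
  rewrite cabsM cabsJ !cabsM.
  apply: (@le_trans _ _ (cabs t ^+ 2 * L * (cabs y * cabs x *+ 2))).
    have twL : cabs t * cabs (w - 1) <= cabs t ^+ 2 * L.
      by rewrite expr2 -mulrA ler_wpM2l// mulrC.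
    rewrite mulrnAr lerMn2r/= -[leLHS]mulrA.
    by apply: ler_wpM2r => //; rewrite mulr_ge0// cabs_ge0.
  rewrite -mulrA; apply: ler_wpM2l; first exact: sqr_ge0.
  apply: ler_wpM2l => //.
  have := sqr_ge0 (cabs x - cabs y); rewrite sqrrB; lra.
have : cabs (t * w * y) ^+ 2 <=
    cabs t ^+ 2 * ((1 + L * delta) ^+ 2 * cabs y ^+ 2).
  rewrite !cabsM !exprMn -[leLHS]mulrA; apply: ler_wpM2l; first exact: sqr_ge0.
  apply: ler_wpM2r; first exact: sqr_ge0.
  by rewrite ler_sqr ?nnegrE ?cabs_ge0// (le_trans (cabs_ge0 w)).
move=> h1 h2; rewrite [X in _ <= _ + X]mulrDr mulrnDl; lra.
Qed.

(** In the direction [t = s z] with [s > 0] the hypothesis reads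
    [2 s |z|^2 <= s^2 |z|^2 K], which fails for small [s] unless [z = 0]. Both
    components of [z] are reached because [t] is complex. *)
Lemma first_order_eq0 (R : realType) (z : R[i]) (K delta : R) :
  0 < delta -> 0 <= K ->
  (forall t : R[i], cabs t <= delta ->
     0 <= - complex.Re (t^* * z) *+ 2 + cabs t ^+ 2 * K) ->
  z = 0.
Proof.
move=> d0 K0 h; apply/eqP; rewrite -cabs_eq0; apply: contraT => z0.
have {z0} zp : 0 < cabs z by rewrite lt_neqAle eq_sym z0 cabs_ge0.
(* The first bound makes [s z] admissible, the second one makes [s K < 1]. *)
pose s := Num.min (delta / cabs z) (K + 1)^-1.
have s0 : 0 < s by rewrite lt_min divr_gt0//= invr_gt0 ltr_wpDl.
have cs : cabs (Complex s 0) = s.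
  by rewrite /cabs/= expr0n addr0 sqrtr_sqr gtr0_norm.
have := h (Complex s 0 * z).
rewrite cabsM cs -ler_pdivlMr// ge_min lexx => /(_ isT).
have -> : complex.Re ((Complex s 0 * z)^* * z) = s * cabs z ^+ 2.
  by rewrite sqr_cabs; case: z {h zp} @s s0 cs => a b s s0 cs /=; ring.
have sK : s * (K + 1) <= 1.
  by rewrite -ler_pdivlMr ?ltr_wpDl// div1r ge_min lexx orbT.
have : 0 < s * cabs z ^+ 2 by rewrite mulr_gt0// exprn_gt0.
move: (cabs z) zp => c c0; rewrite exprMn => sc; nra.
Qed.

Section FirstVariation.
Context d (T : measurableType d) (R : realType).
Variables (mu : {measure set T -> \bar R}) (D : set T) (mD : measurable D).

Lemma integrable_sqr_frobenius m n (F : T -> 'M[R[i]]_(m, n)) :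
  (forall i j, square_integrable mu D (fun x => F x i j)) ->
  mu.-integrable D (EFin \o (fun x => frobenius (F x) ^+ 2)).
Proof.
move=> Fi; have -> : EFin \o (fun x => frobenius (F x) ^+ 2) =
    (fun x => (\sum_i \sum_j (cabs (F x i j) ^+ 2)%:E)%E).
  apply/funext => x /=; rewrite sqr_frobenius -sumEFin.
  by apply: eq_bigr => i _; rewrite -sumEFin.
apply: integrable_sum => // i _; apply: integrable_sum => // j _.
by have [] := Fi i j.
Qed.

(** Integrating [sqr_cabs_first_order]. The factor [w] lets the perturbation
    [E'] be nonlinear in [t]; only its derivative [V] at [t = 0] enters the
    conclusion. *)
Lemma first_variation m n (E V : T -> 'M[R[i]]_(m, n)) (L delta : R) :
  (forall i j, square_integrable mu D (fun x => E x i j)) ->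
  (forall i j, square_integrable mu D (fun x => V x i j)) ->
  0 <= L -> 0 < delta ->
  (forall t : R[i], cabs t <= delta ->
     exists (E' : T -> 'M[R[i]]_(m, n)) (w : T -> R[i]),
     [/\ forall i j, cmeasurable D (fun x => E' x i j),
         {ae mu, forall x, D x ->
            E' x = E x - (t * w x) *: V x /\ cabs (w x - 1) <= L * cabs t} &
         (\int[mu]_(x in D) (frobenius (E x) ^+ 2)%:E <=
          \int[mu]_(x in D) (frobenius (E' x) ^+ 2)%:E)%E]) ->
  cintegral mu D (fun x => \sum_i \sum_j (V x i j)^* * E x i j) = 0.
Proof.
move=> Ei Vi L0 d0 h.
pose q x := \sum_i \sum_j (V x i j)^* * E x i j.
pose e x := frobenius (E x) ^+ 2.
pose v x := frobenius (V x) ^+ 2.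
pose k x := L * (e x + v x) + (1 + L * delta) ^+ 2 * v x.
have ei : mu.-integrable D (EFin \o e) by exact: integrable_sqr_frobenius.
have vi : mu.-integrable D (EFin \o v) by exact: integrable_sqr_frobenius.
have qi : cintegrable mu D q.
  apply: cintegrable_sum => // i; apply: cintegrable_sum => // j.
  by apply: square_integrable_cintegrableM => //; exact: square_integrableJ.
have ki : mu.-integrable D (EFin \o k).
  have evi := integrableZl mD L (integrableD mD ei vi).
  exact: (integrableD mD evi (integrableZl mD ((1 + L * delta) ^+ 2) vi)).
pose K := \int[mu]_(x in D) k x.
have K0 : 0 <= K.
  apply: Rintegral_ge0 => x _; have [e0 v0] : 0 <= e x /\ 0 <= v x.
    by split; exact: sqr_ge0.
  apply: addr_ge0; first by rewrite mulr_ge0// addr_ge0.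
  by apply: mulr_ge0 => //; exact: sqr_ge0.
apply: (first_order_eq0 d0 K0) => t td.
have [E' [w [mE' E'E EE']]] := h t td.
have [q1 q2] := qi.
have ReJM (z : R[i]) : complex.Re (t^* * z) =
    complex.Re t * complex.Re z + complex.Im t * complex.Im z.
  by rewrite complex_ReM complex_ReJ complex_ImJ mulNr opprK.
pose p x := complex.Re t * complex.Re (q x) + complex.Im t * complex.Im (q x).
have pq x : p x = complex.Re (t^* * q x) by rewrite ReJM.
have q1i : mu.-integrable D (EFin \o (fun x => complex.Re t * complex.Re (q x))).
  exact: (integrableZl mD (complex.Re t) q1).
have q2i : mu.-integrable D (EFin \o (fun x => complex.Im t * complex.Im (q x))).
  exact: (integrableZl mD (complex.Im t) q2).
have pint : mu.-integrable D (EFin \o p).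
  exact: (integrableD mD q1i q2i).
have p2i : mu.-integrable D (EFin \o (fun x => p x + p x)).
  exact: (integrableD mD pint pint).
have epi : mu.-integrable D (EFin \o (fun x => e x - (p x + p x))).
  exact: (integrableB mD ei p2i).
have tki : mu.-integrable D (EFin \o (fun x => cabs t ^+ 2 * k x)).
  exact: (integrableZl mD (cabs t ^+ 2) ki).
pose g x := e x - (p x + p x) + cabs t ^+ 2 * k x.
have gi : mu.-integrable D (EFin \o g).
  exact: (integrableD mD epi tki).
have intg : \int[mu]_(x in D) g x = \int[mu]_(x in D) e x
    - complex.Re (t^* * cintegral mu D q) *+ 2 + cabs t ^+ 2 * K.
  rewrite /g RintegralD// RintegralB// RintegralD// RintegralZl// /p.
  by rewrite RintegralD// !RintegralZl// ReJM mulr2n.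
have e'g : {ae mu, forall x, D x -> frobenius (E' x) ^+ 2 <= g x}.
  apply: filterS E'E => x /[apply] -[-> wL].
  apply: (@le_trans _ _ (\sum_i \sum_j (cabs (E x i j) ^+ 2 -
      complex.Re (t^* * ((V x i j)^* * E x i j)) *+ 2 +
      cabs t ^+ 2 * (L * (cabs (E x i j) ^+ 2 + cabs (V x i j) ^+ 2) +
                     (1 + L * delta) ^+ 2 * cabs (V x i j) ^+ 2)))).
    rewrite sqr_frobenius; apply: ler_sum => i _; apply: ler_sum => j _.
    by rewrite !mxE; exact: sqr_cabs_first_order.
  rewrite /g /k /e /v !sqr_frobenius !pq -mulr2n /q mulr_sumr complex_Re_sum.
  under eq_bigr => i _ do rewrite big_split/= sumrB sumrMnl -mulr_sumr
    big_split/= -!mulr_sumr big_split/= -complex_Re_sum -mulr_sumr.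
  by rewrite big_split/= sumrB sumrMnl -mulr_sumr big_split/= -!mulr_sumr
    big_split/=.
have e'i : mu.-integrable D (EFin \o (fun x => frobenius (E' x) ^+ 2)).
  apply: (ae_le_integrable mD _ gi).
    under eq_fun do rewrite sqr_frobenius.
    apply: measurable_sum => i; apply: measurable_sum => j.
    exact: measurable_sqr_cabs.
  by apply: filterS e'g => x e'g Dx; rewrite ger0_norm ?sqr_ge0// e'g.
have : \int[mu]_(x in D) e x <= \int[mu]_(x in D) frobenius (E' x) ^+ 2.
  by apply: fine_le => //; exact: integrable_fin_num.
move=> /le_trans /(_ (ae_le_Rintegral mD e'i gi e'g)).
rewrite intg; lra.
Qed.

End FirstVariation.

(** * Diagonal structured models *)

Lemma invmx_diag (F : fieldType) n (A : 'M[F]_n) : is_diag_mx A ->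
  A \in unitmx -> invmx A = diag_mx (\row_i (A i i)^-1).
Proof.
move=> /diag_mxP[e ->] Au.
have e0 i : e 0 i != 0.
  by move: Au; rewrite unitmxE unitfE det_diag => /prodf_neq0 /(_ i isT).
rewrite -[LHS]mulmx1; apply: (canLR (mulKmx Au)).
rewrite mulmx_diag -diag_const_mx; congr diag_mx; apply/rowP => i.
by rewrite !mxE eqxx mulr1n divff.
Qed.

Lemma unitmx_diag (F : fieldType) n (A : 'M[F]_n) : is_diag_mx A ->
  (A \in unitmx) = [forall i, A i i != 0].
Proof.
move=> /diag_mxP[e ->]; rewrite unitmxE unitfE det_diag.
apply/prodf_neq0/forallP => [h i|h i _].
  by have := h i isT; rewrite mxE eqxx.
by have := h i; rewrite mxE eqxx.
Qed.

Section StructuredModels.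
Context d (T : measurableType d) (R : realType) (no ni r qA qB qC : nat).
Variables (mu : {measure set T -> \bar R}) (P : set T) (mP : measurable P).
Variables (alpha : 'I_qA -> T -> R[i]) (beta : 'I_qB -> T -> R[i])
          (gamma : 'I_qC -> T -> R[i]).
Local Notation rom := (structured_rom R no ni r qA qB qC).
Implicit Types S : rom.

Lemma calA_diag S p : (forall i, is_diag_mx (romA S i)) ->
  is_diag_mx (calA alpha S p).
Proof.
move=> dA; apply/is_diag_mxP => k l kl; rewrite summxE big1// => i _.
by rewrite mxE (is_diag_mxP (dA i))// mulr0.
Qed.

Lemma Hhat_diagE S p : (forall i, is_diag_mx (romA S i)) ->
  (forall l, diag_a alpha S l p != 0) ->
  forall m n, Hhat alpha beta gamma S p m n =
    \sum_l calC gamma S p m l * calB beta S p l n / diag_a alpha S l p.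
Proof.
move=> dA a0 m n; have dp := calA_diag p dA.
have Au : calA alpha S p \in unitmx by rewrite unitmx_diag//; exact/forallP.
rewrite /Hhat invmx_diag// mxE; apply: eq_bigr => l _.
by rewrite mul_mx_diag !mxE mulrAC.
Qed.

(** The pointwise form, for diagonal models, of the boundedness of
    [alpha_i calA^-1]; see [Sigma_DStP]. *)
Definition uniformly_dominated S (K : R) : Prop :=
  {ae mu, forall p, P p -> forall l, diag_a alpha S l p != 0 /\
     forall i, cabs (alpha i p) <= K * cabs (diag_a alpha S l p)}.

Lemma ae_mrestr (Q : T -> Prop) :
  (\forall p \ae mrestr mu mP, Q p) <-> {ae mu, forall p, P p -> Q p}.
Proof.
split=> [[N [mN N0 QN]]|[N [mN N0 QN]]].
  exists (N `&` P); split => //; first exact: measurableI.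
  move=> p /= /not_implyP[Pp nQ]; split=> //; exact: QN.
exists (N `|` ~` P); split.
- by apply: measurableU => //; exact: measurableC.
- rewrite /mrestr setIUl setICl setU0.
  by apply: (subset_measure0 _ _ _ N0) => //; exact: measurableI.
- move=> p /= nQ; have [Pp|] := pselect (P p); last by right.
  by left; apply: QN => /= /(_ Pp).
Qed.

(** The inverse of a diagonal matrix has the entries [1 / a_l], so the
    Frobenius norm of [alpha_i calA^-1] is bounded exactly when all quotients
    [alpha_i / a_l] are. *)
Lemma Sigma_DStP S : Sigma_DSt mu mP alpha S <->
  (forall i, is_diag_mx (romA S i)) /\ exists K, uniformly_dominated S K.
Proof.
split=> [[[Au As] dA]|[dA [K SK]]].
  split=> //.
  have /choice[M MP] : forall i, exists M : R, {ae mu, forall p, P p ->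
      frobenius (alpha i p *: invmx (calA alpha S p)) <= M}.
    move=> i; have [M EM] : exists M : R, (ess_sup (mrestr mu mP)
       (fun p => (frobenius (alpha i p *: invmx (calA alpha S p)))%:E) <= M%:E)%E.
      move: (As i); case: ess_sup => [M _|//|_]; first by exists M.
      by exists 0; rewrite leNye.
    exists M; apply/ae_mrestr; move/ess_supP : EM.
    by apply: filterS => p; rewrite lee_fin.
  have {}MP := filter_forall (ae_filter_ringOfSetsType mu) MP.
  exists (\sum_i `|M i|); move: Au MP; apply: filterS2 => p Au MP Pp l.
  have {}Au := Au Pp; have dp := calA_diag p dA.
  have a0 : forall l, calA alpha S p l l != 0.
    by apply/forallP; rewrite -unitmx_diag.
  split; first exact: a0.
  move=> i; rewrite -ler_pdivrMr; last first.
    by rewrite lt_neqAle eq_sym cabs_eq0 a0 cabs_ge0.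
  rewrite -cabsV -cabsM; apply: le_trans (_ : M i <= _); last first.
    rewrite (bigD1 i)//=; apply: (le_trans (ler_norm _)).
    by rewrite lerDl sumr_ge0.
  apply: le_trans (MP i Pp).
  have := cabs_le_frobenius (alpha i p *: invmx (calA alpha S p)) l l.
  by rewrite invmx_diag// !mxE eqxx.
split=> //; split.
  apply: filterS SK => p SK Pp; rewrite unitmx_diag; last exact: calA_diag.
  by apply/forallP => l; have [] := SK Pp l.
move=> i; apply: (@le_lt_trans _ _
  (Num.sqrt (\sum_(k < r) \sum_(l < r) `|K| ^+ 2))%:E); last exact: ltry.
apply/ess_supP/ae_mrestr; apply: filterS SK => p SK Pp.
have a0 : forall l, diag_a alpha S l p != 0 by move=> l; have [] := SK Pp l.
rewrite lee_fin ler_wsqrtr//; apply: ler_sum => k _; apply: ler_sum => l _.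
have dp := calA_diag p dA.
rewrite invmx_diag//; last by rewrite unitmx_diag//; exact/forallP.
rewrite !mxE ler_sqr ?nnegrE ?cabs_ge0//.
have [_|_] := eqVneq k l; last by rewrite mulr0n mulr0 cabs0.
rewrite mulr1n cabsM cabsV ler_pdivrMr; last first.
  by rewrite lt_neqAle eq_sym cabs_eq0 a0 cabs_ge0.
have [_ /(_ i) /le_trans] := SK Pp k; apply.
by rewrite ler_wpM2r ?cabs_ge0// ler_norm.
Qed.

(** Bounds the entries of [calA], [calB] and [calC] by the sums of
    moduli that occur in [coeff_ratio]. *)
Lemma cabs_lincomb_le m n q (x : 'I_q -> R[i]) (X : 'I_q -> 'M[R[i]]_(m, n)) i j :
  cabs ((\sum_k x k *: X k) i j) <=
  (\sum_k cabs (X k i j)) * \sum_k cabs (x k).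
Proof.
rewrite summxE; apply: (le_trans (cabs_sum _)); rewrite mulr_sumr.
apply: ler_sum => k _; rewrite mxE cabsM mulrC ler_wpM2r ?cabs_ge0//.
exact: (cabs_le_sum (fun k => X k i j)).
Qed.

Lemma cmeasurable_lincomb m n q (x : 'I_q -> T -> R[i])
    (X : 'I_q -> 'M[R[i]]_(m, n)) : (forall k, cmeasurable P (x k)) ->
  forall i j, cmeasurable P (fun p => (\sum_k x k p *: X k) i j).
Proof.
move=> mx i j; under eq_fun do rewrite summxE.
apply: cmeasurable_sum => k; under eq_fun do rewrite mxE.
by apply: cmeasurableM => //; exact: cmeasurable_cst.
Qed.

Hypothesis alpha_meas : forall i, cmeasurable P (alpha i).
Hypothesis beta_meas : forall j, cmeasurable P (beta j).
Hypothesis gamma_meas : forall k, cmeasurable P (gamma k).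

Lemma cmeasurable_Hhat S m n :
  cmeasurable P (fun p => Hhat alpha beta gamma S p m n).
Proof.
apply: cmeasurable_mulmx; last exact: cmeasurable_lincomb.
apply: cmeasurable_mulmx; first exact: cmeasurable_lincomb.
by apply: cmeasurable_invmx; exact: cmeasurable_lincomb.
Qed.

Lemma cmeasurable_diag_a S l : cmeasurable P (diag_a alpha S l).
Proof. exact: cmeasurable_lincomb. Qed.

(** Up to constants, this bounds every term [c_l b_l^* / a_l] of the transfer
    function of an admissible diagonal model. *)
Definition coeff_ratio (p : T) : R :=
  (\sum_j cabs (beta j p)) * (\sum_k cabs (gamma k p)) / (\sum_i cabs (alpha i p)).

Hypothesis coeff_L2 : (\int[mu]_(p in P) (coeff_ratio p ^+ 2)%:E < +oo)%E.

Lemma integrable_sqr_coeff_ratio :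
  mu.-integrable P (EFin \o (fun p => coeff_ratio p ^+ 2)).
Proof.
apply/integrableP; split; last first.
  apply: le_lt_trans coeff_L2; rewrite le_eqVlt; apply/orP; left; apply/eqP.
  by apply: eq_integral => p _; rewrite /= ger0_norm ?sqr_ge0.
apply/measurable_EFinP/measurable_funX.
have msum q (x : 'I_q -> T -> R[i]) : (forall k, cmeasurable P (x k)) ->
    measurable_fun P (fun p => \sum_k cabs (x k p)).
  by move=> mx; apply: measurable_sum => k; exact: measurable_cabs.
apply: measurable_funM.
  by apply: measurable_funM; exact: msum.
apply: measurable_fun_inv_ge0; last exact: msum.
by move=> p; apply: sumr_ge0 => i _; exact: cabs_ge0.
Qed.

(** Domination gives [sum_i |alpha_i| <= qA K |a_l|], hence [|u v / a_l|] is at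
    most [M N qA K] times [coeff_ratio]. *)
Lemma square_integrable_term S K (u v : T -> R[i]) (M N : R) l :
  uniformly_dominated S K -> cmeasurable P u -> cmeasurable P v ->
  0 <= M -> 0 <= N ->
  (forall p, cabs (u p) <= M * \sum_k cabs (gamma k p)) ->
  (forall p, cabs (v p) <= N * \sum_j cabs (beta j p)) ->
  square_integrable mu P (fun p => u p * v p / diag_a alpha S l p).
Proof.
move=> SK mes_u mes_v M0 N0 uM vN.
have MN0 : 0 <= M * N by exact: mulr_ge0.
apply: (square_integrable_dominated (K := M * N * (qA%:R * K)) mP _
  integrable_sqr_coeff_ratio).
  apply: cmeasurableM; first exact: cmeasurableM.
  by apply: cmeasurableV; exact: cmeasurable_diag_a.
apply: filterS SK => p SK Pp; have {SK}[a0 aK] := SK Pp l.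
have fM : cabs (u p * v p / diag_a alpha S l p) <= M * N *
    ((\sum_j cabs (beta j p)) * (\sum_k cabs (gamma k p)) /
     cabs (diag_a alpha S l p)).
  rewrite !cabsM cabsV mulrA ler_wpM2r ?invr_ge0 ?cabs_ge0//.
  rewrite [_ * (\sum_k cabs (gamma k p))]mulrC mulrACA.
  by apply: ler_pM; rewrite ?cabs_ge0.
apply: (le_trans fM); rewrite -[leRHS]mulrA ler_wpM2l//.
rewrite /coeff_ratio [leRHS]mulrCA ler_wpM2l//.
  by rewrite mulr_ge0// sumr_ge0// => ? _; exact: cabs_ge0.
have ap : 0 < cabs (diag_a alpha S l p).
  by rewrite lt_neqAle eq_sym cabs_eq0 a0 cabs_ge0.
(* Not all [alpha_i] vanish where [a_l], a combination of them, does not. *)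
have sp : 0 < \sum_i cabs (alpha i p).
  rewrite lt_neqAle sumr_ge0 ?andbT; last by move=> i _; exact: cabs_ge0.
  apply: contraNneq a0 => s0; rewrite -cabs_eq0.
  have := cabs_lincomb_le (fun i => alpha i p) (romA S) l l.
  by rewrite -s0 mulr0 => ?; rewrite eq_le cabs_ge0 andbT.
rewrite ler_pdivlMr// mulrC ler_pdivrMr//.
apply: (@le_trans _ _ (\sum_(i < qA) K * cabs (diag_a alpha S l p))).
  by apply: ler_sum.
by rewrite sumr_const card_ord -mulrA mulr_natl.
Qed.

Lemma square_integrable_Hhat S K : (forall i, is_diag_mx (romA S i)) ->
  uniformly_dominated S K ->
  forall m n, square_integrable mu P (fun p => Hhat alpha beta gamma S p m n).
Proof.
move=> dA SK m n.
pose F p := \sum_l calC gamma S p m l * calB beta S p l n / diag_a alpha S l p.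
have [mF Fi] : square_integrable mu P F.
  apply: square_integrable_sum => // l.
  apply: (square_integrable_term l SK (M := \sum_k cabs (romC S k m l))
      (N := \sum_j cabs (romB S j l n))).
  1,2: exact: cmeasurable_lincomb.
  1,2: by rewrite sumr_ge0// => ? _; exact: cabs_ge0.
  1,2: by move=> p; exact: cabs_lincomb_le.
apply: (square_integrable_dominated (K := 1) mP _ Fi).
  exact: cmeasurable_Hhat.
apply: filterS SK => p SK Pp; rewrite mul1r Hhat_diagE// => l.
by have [] := SK Pp l.
Qed.

End StructuredModels.

(** * Stationarity of an optimal diagonal model *)

(** Unlike [mxE], this does not expand [X] or [Y] when they are themselves
    matrix products. *)
Lemma subr_mxE (V : zmodType) m n (X Y : 'M[V]_(m, n)) i j :
  (X - Y) i j = X i j - Y i j.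
Proof. by rewrite !mxE. Qed.

Definition perturb (V : zmodType) q (X : 'I_q -> V) k (e : V) : 'I_q -> V :=
  fun k' => if k' == k then X k' + e else X k'.

Lemma lincomb_perturb (R : comRingType) q m n (x : 'I_q -> R)
    (X : 'I_q -> 'M[R]_(m, n)) k t (D : 'M[R]_(m, n)) :
  \sum_k' x k' *: perturb X k (t *: D) k' =
  \sum_k' x k' *: X k' + (t * x k) *: D.
Proof.
rewrite (bigD1 k)//= [in RHS](bigD1 k)//= /perturb eqxx scalerDr scalerA.
rewrite [x k * t]mulrC addrAC; congr (_ + _ + _).
by apply: eq_bigr => i /negPf ->.
Qed.

Section Stationarity.
Context d (T : measurableType d) (R : realType) (no ni r qA qB qC : nat).
Variables (mu : {measure set T -> \bar R}) (P : set T) (mP : measurable P).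
Variables (alpha : 'I_qA -> T -> R[i]) (beta : 'I_qB -> T -> R[i])
          (gamma : 'I_qC -> T -> R[i]).
Hypothesis alpha_meas : forall i, cmeasurable P (alpha i).
Hypothesis beta_meas : forall j, cmeasurable P (beta j).
Hypothesis gamma_meas : forall k, cmeasurable P (gamma k).
Hypothesis coeff_L2 :
  (\int[mu]_(p in P) (coeff_ratio alpha beta gamma p ^+ 2)%:E < +oo)%E.
Variable H : T -> 'M[R[i]]_(no, ni).
Hypothesis H_L2 : mx_L2 mu P H.
Variable S : structured_rom R no ni r qA qB qC.
Hypothesis S_opt : L2_optimal mu P alpha beta gamma H (Sigma_DSt mu mP alpha) S.

Local Notation Hh := (Hhat alpha beta gamma S).
Local Notation a := (diag_a alpha S).

Lemma square_integrable_target m n :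
  square_integrable mu P (fun p => H p m n).
Proof.
have [mH Hoo] := H_L2.
apply: (square_integrable_dominated (g := fun p => frobenius (H p)) (K := 1)
  mP (mH m n)); last by apply: aeW => p _; rewrite mul1r cabs_le_frobenius.
apply/integrableP; split.
  apply/measurable_EFinP; under eq_fun do rewrite sqr_frobenius.
  apply: measurable_sum => i; apply: measurable_sum => j.
  exact: measurable_sqr_cabs.
under eq_integral do rewrite /= ger0_norm ?sqr_ge0//.
exact: Hoo.
Qed.

Lemma optimal_diag i : is_diag_mx (romA S i).
Proof. by have [[_ dA] _] := S_opt. Qed.

Lemma optimal_dominated :
  exists2 K : R, 0 <= K & uniformly_dominated mu P alpha S K.
Proof.
have [/Sigma_DStP[_ [K SK]] _] := S_opt; exists `|K| => //.
apply: filterS SK => p SK Pp l; have [a0 aK] := SK Pp l; split=> // i.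
by rewrite (le_trans (aK i))// ler_wpM2r ?cabs_ge0// ler_norm.
Qed.

Lemma square_integrable_optimal m n :
  square_integrable mu P (fun p => Hh p m n).
Proof.
have [K _ SK] := optimal_dominated.
exact: (square_integrable_Hhat mP _ _ _ _ optimal_diag SK).
Qed.

(** Square integrability is part of the notion because it lets the single
    vanishing integral be split into two existing ones, for [H] and for
    [Hhat]. *)
Definition stationary (V : T -> 'M[R[i]]_(no, ni)) : Prop :=
  (forall m n, square_integrable mu P (fun p => V p m n)) /\
  cintegral mu P (fun p => \sum_m \sum_n (V p m n)^* * (H p - Hh p) m n) = 0.

Lemma optimal_stationary (V : T -> 'M[R[i]]_(no, ni)) (L delta : R) :
  (forall m n, square_integrable mu P (fun p => V p m n)) ->
  0 <= L -> 0 < delta ->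
  (forall t : R[i], cabs t <= delta ->
     exists (S' : structured_rom R no ni r qA qB qC) (w : T -> R[i]),
     Sigma_DSt mu mP alpha S' /\
     {ae mu, forall p, P p ->
        Hhat alpha beta gamma S' p = Hh p + (t * w p) *: V p /\
        cabs (w p - 1) <= L * cabs t}) ->
  stationary V.
Proof.
move=> Vi L0 d0 h; split=> //; apply: (first_variation mP _ Vi L0 d0).
  move=> m n; under eq_fun do rewrite subr_mxE.
  apply: square_integrableB => //; first exact: square_integrable_target.
  exact: square_integrable_optimal.
move=> t td; have [S' [w [S'D S'V]]] := h t td.
exists (fun p => H p - Hhat alpha beta gamma S' p), w; split.
- move=> m n; under eq_fun do rewrite subr_mxE; apply: cmeasurableB.
    by have [] := square_integrable_target m n.
  exact: cmeasurable_Hhat.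
- apply: filterS S'V => p S'V Pp; have [-> wL] := S'V Pp.
  by rewrite opprD addrA.
- by have [_ min_S] := S_opt; exact: (min_S S' S'D).
Qed.

(** Direction of the entry [(m, l)] of [C_k], on which the transfer function
    depends affinely. *)
Lemma stationary_C k m l :
  stationary (fun p => \matrix_(m', n)
    ((m' == m)%:R * (gamma k p * calB beta S p l n / a l p))).
Proof.
have [K K0 SK] := optimal_dominated.
apply: (@optimal_stationary _ 0 1) => //.
  move=> m' n; under eq_fun do rewrite mxE.
  apply: (square_integrableM_bounded (K := 1) mP) => //.
  - by apply: aeW => p _; exact: cabs_natb.
  - apply: (square_integrable_term mP alpha_meas beta_meas gamma_meas coeff_L2
      l SK (M := 1) (N := \sum_j cabs (romB S j l n))) => //.
    + exact: cmeasurable_lincomb.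
    + by rewrite sumr_ge0// => ? _; exact: cabs_ge0.
    + by move=> p; rewrite mul1r; exact: (cabs_le_sum (gamma^~ p)).
    + by move=> p; exact: cabs_lincomb_le.
move=> t _; exists (StructuredRom (romA S) (romB S)
  (perturb (romC S) k (t *: delta_mx m l))), (fun=> 1).
split; first by have [] := S_opt.
apply: filterS SK => p SK Pp; have a0 l' : a l' p != 0 by have [] := SK Pp l'.
split; last by rewrite subrr cabs0 mul0r.
apply/matrixP => m' n; rewrite Hhat_diagE//; last exact: optimal_diag.
rewrite mulr1 mxE Hhat_diagE//; last exact: optimal_diag.
rewrite /calC /= lincomb_perturb.
under eq_bigr => l' _ do rewrite mxE 2!mulrDl.
rewrite big_split/=; congr (_ + _).
rewrite (bigD1 l)//= big1 ?addr0; last first.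
  by move=> l' /negPf l'l; rewrite !mxE l'l andbF mulr0 !mul0r.
rewrite !mxE eqxx andbT -/(calB beta S p); ring.
Qed.

(** Direction of the entry [(l, n)] of [B_j], on which the transfer function
    depends affinely. *)
Lemma stationary_B j n l :
  stationary (fun p => \matrix_(m, n')
    ((n' == n)%:R * (calC gamma S p m l * beta j p / a l p))).
Proof.
have [K K0 SK] := optimal_dominated.
apply: (@optimal_stationary _ 0 1) => //.
  move=> m n'; under eq_fun do rewrite mxE.
  apply: (square_integrableM_bounded (K := 1) mP) => //.
  - by apply: aeW => p _; exact: cabs_natb.
  - apply: (square_integrable_term mP alpha_meas beta_meas gamma_meas coeff_L2
      l SK (N := 1) (M := \sum_k cabs (romC S k m l))) => //.
    + exact: cmeasurable_lincomb.
    + by rewrite sumr_ge0// => ? _; exact: cabs_ge0.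
    + by move=> p; exact: cabs_lincomb_le.
    + by move=> p; rewrite mul1r; exact: (cabs_le_sum (beta^~ p)).
move=> t _; exists (StructuredRom (romA S)
  (perturb (romB S) j (t *: delta_mx l n)) (romC S)), (fun=> 1).
split; first by have [] := S_opt.
apply: filterS SK => p SK Pp; have a0 l' : a l' p != 0 by have [] := SK Pp l'.
split; last by rewrite subrr cabs0 mul0r.
apply/matrixP => m n'; rewrite Hhat_diagE//; last exact: optimal_diag.
rewrite mulr1 mxE Hhat_diagE//; last exact: optimal_diag.
rewrite /calB /= lincomb_perturb.
under eq_bigr => l' _ do rewrite mxE mulrDr mulrDl.
rewrite big_split/=; congr (_ + _).
rewrite (bigD1 l)//= big1 ?addr0; last first.
  by move=> l' /negPf l'l; rewrite !mxE l'l mulr0 mulr0 mul0r.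
rewrite !mxE eqxx -/(calC gamma S p); ring.
Qed.

(** Direction of the diagonal entry [(l, l)] of [A_i]. The transfer function is
    only rational in it, but for [K |t| <= 1/2] the modulus of the perturbed
    [a_l] is at least half of that of [a_l]. This keeps the model admissible and
    makes the first-order expansion in [t] uniform in [p]. *)
Lemma stationary_A i l :
  stationary (fun p => \matrix_(m, n)
    ((alpha i p / a l p) *
     (calC gamma S p m l * calB beta S p l n / a l p))).
Proof.
have [K K0 SK] := optimal_dominated.
have K1 : 0 < K + 1 by rewrite ltr_wpDl.
(* The radius ensures [K |t| <= 1/2], and [K + 1] is positive even if [K = 0]. *)
apply: (@optimal_stationary _ (2 * K) (2 * (K + 1))^-1).
- move=> m n; under eq_fun do rewrite mxE.
  apply: (square_integrableM_bounded (K := K) mP) => //.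
  + apply: cmeasurableM => //.
    by apply: cmeasurableV; exact: cmeasurable_diag_a.
  + apply: filterS SK => p SK Pp; have [a0 aK] := SK Pp l.
    rewrite cabsM cabsV ler_pdivrMr//.
    by rewrite lt_neqAle eq_sym cabs_eq0 a0 cabs_ge0.
  + apply: (square_integrable_term mP alpha_meas beta_meas gamma_meas coeff_L2
      l SK (M := \sum_k cabs (romC S k m l))
      (N := \sum_j cabs (romB S j l n))).
    1,2: exact: cmeasurable_lincomb.
    1,2: by rewrite sumr_ge0// => ? _; exact: cabs_ge0.
    1,2: by move=> p; exact: cabs_lincomb_le.
- by rewrite mulr_ge0.
- by rewrite invr_gt0 mulr_gt0.
move=> t td.
have tK : cabs t * K <= 2^-1.
  apply: (@le_trans _ _ (cabs t * (K + 1))).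
    by rewrite ler_wpM2l ?cabs_ge0// lerDl.
  by rewrite -ler_pdivlMr// -invfM.
(* Subtracting [t] gives [1 / a_l] the derivative [+ alpha_i / a_l^2]. *)
pose S' := StructuredRom (perturb (romA S) i (- t *: delta_mx l l))
  (romB S) (romC S).
have a'E l' p : diag_a alpha S' l' p =
    a l' p - (l' == l)%:R * (t * alpha i p).
  rewrite /diag_a /calA /= lincomb_perturb !mxE andbb mulNr mulNr.
  by rewrite [_ * (l' == l)%:R]mulrC.
have dA' i' : is_diag_mx (romA S' i').
  rewrite /= /perturb; case: eqP => _; last exact: optimal_diag.
  apply/is_diag_mxP => k m km.
  rewrite !mxE (is_diag_mxP (optimal_diag i'))// add0r.
  have [kl|_] := eqVneq k l; last by rewrite mulr0.
  suff /negPf -> : m != l by rewrite mulr0.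
  by apply: contraNneq km => ->; rewrite kl.
(* Since [|t alpha_i| <= K |t| |a_l| <= |a_l| / 2]. *)
have key : {ae mu, forall p, P p -> forall l',
    cabs (a l' p) <= 2 * cabs (diag_a alpha S' l' p)}.
  apply: filterS SK => p SK Pp l'; have [a0 aK] := SK Pp l'.
  rewrite a'E; set x := _ * (t * _).
  have xK : cabs x <= 2^-1 * cabs (a l' p).
    apply: (@le_trans _ _ (cabs t * K * cabs (a l' p))); last first.
      by rewrite ler_wpM2r ?cabs_ge0.
    rewrite -mulrA cabsM -[leRHS]mul1r; apply: ler_pM; rewrite ?cabs_ge0//.
      exact: cabs_natb.
    by rewrite cabsM ler_wpM2l ?cabs_ge0.
  have := cabsD (a l' p - x) x; rewrite subrK; lra.
have SK' : uniformly_dominated mu P alpha S' (2 * K).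
  move: SK key; apply: filterS2 => p SK key Pp l'.
  have [a0 aK] := SK Pp l'; have {}key := key Pp l'; split.
    apply: contraNneq a0 => a'0; move: key.
    by rewrite a'0 cabs0 mulr0 -cabs_eq0 eq_le cabs_ge0 andbT.
  move=> i'; apply: (le_trans (aK i')).
  by rewrite mulrAC mulrC ler_wpM2r.
exists S', (fun p => a l p / diag_a alpha S' l p).
split; first by apply/Sigma_DStP; split => //; exists (2 * K).
move: SK SK' key; apply: filterS3 => p SK SK' key Pp.
have a0 l' : a l' p != 0 by have [] := SK Pp l'.
have a'0 l' : diag_a alpha S' l' p != 0 by have [] := SK' Pp l'.
have a'l : diag_a alpha S' l p = a l p - t * alpha i p.
  by rewrite a'E eqxx mul1r.
split.
  apply/matrixP => m n; rewrite Hhat_diagE//.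
  rewrite [RHS]mxE Hhat_diagE//; last exact: optimal_diag.
  rewrite (bigD1 l)//= [in RHS](bigD1 l)//= addrAC; congr (_ + _); last first.
    by apply: eq_bigr => l' /negPf l'l; rewrite a'E l'l mul0r subr0.
  rewrite 2!mxE -/(calC gamma S p) -/(calB beta S p).
  have := a'0 l; rewrite a'l; have := a0 l.
  move: (a l p) (alpha i p) (calC gamma S p m l) (calB beta S p l n).
  by move=> x y c b x0 xy0; field; rewrite x0 xy0.
have [_ /(_ i) aK] := SK Pp l.
have -> : a l p / diag_a alpha S' l p - 1 =
    t * alpha i p / diag_a alpha S' l p.
  by rewrite -[X in _ - X](divff (a'0 l)) -mulrBl [X in _ - X]a'l subKr.
rewrite cabsM cabsV ler_pdivrMr; last first.
  by rewrite lt_neqAle eq_sym cabs_eq0 a'0 cabs_ge0.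
rewrite cabsM; apply: (@le_trans _ _ (cabs t * (K * cabs (a l p)))).
  by rewrite ler_wpM2l ?cabs_ge0.
apply: (@le_trans _ _ (cabs t * (K * (2 * cabs (diag_a alpha S' l p))))).
  by rewrite ler_wpM2l ?cabs_ge0// ler_wpM2l// key.
by rewrite le_eqVlt; apply/orP; left; apply/eqP; ring.
Qed.

(** The form in which stationarity is used: each entry of the two integrands is
    the inner product of a stationary direction with [H], respectively with
    [Hhat]. *)
Lemma eq_mx_integral_pairing m n (F : T -> 'M[R[i]]_(no, ni) -> 'M[R[i]]_(m, n)) :
  (forall i j, exists2 V, stationary V & forall p X,
     F p X i j = \sum_k \sum_l (V p k l)^* * X k l) ->
  eq_mx_integral mu P (fun p => F p (H p)) (fun p => F p (Hh p)).
Proof.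
move=> FV.
have Fi (X : T -> 'M[R[i]]_(no, ni)) :
    (forall k l, square_integrable mu P (fun p => X p k l)) ->
    mx_integrable mu P (fun p => F p (X p)).
  move=> Xi i j; have [V [Vi _] FE] := FV i j; under eq_fun do rewrite FE.
  apply: cintegrable_sum => // k; apply: cintegrable_sum => // l.
  by apply: square_integrable_cintegrableM => //; exact: square_integrableJ.
have HFi := Fi _ square_integrable_target.
have HhFi := Fi _ square_integrable_optimal.
split=> //; apply/matrixP => i j; rewrite !mxE; apply/eqP; rewrite -subr_eq0.
have [V [_ V0] FE] := FV i j; rewrite -cintegralB// -V0; apply/eqP.
congr cintegral; apply/funext => p; rewrite !FE -sumrB.
apply: eq_bigr => k _; rewrite -sumrB; apply: eq_bigr => l _.
by rewrite subr_mxE mulrBr.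
Qed.

End Stationarity.

(** * The interpolation conditions *)

(* The sigma-algebra carrying mu is arbitrary: it is the one generated by G. *)
Theorem corollary2p4 (R : realType) (np no ni r qA qB qC : nat)
  (np_gt0 : (0 < np)%N) (no_gt0 : (0 < no)%N) (ni_gt0 : (0 < ni)%N)
  (r_gt0 : (0 < r)%N)
  (qA_gt0 : (0 < qA)%N) (qB_gt0 : (0 < qB)%N) (qC_gt0 : (0 < qC)%N)
  (G : set (set 'cV[R[i]]_np))
  (mu : {measure set (g_sigma_algebraType G) -> \bar R})
  (P : set 'cV[R[i]]_np) (mP : G.-sigma.-measurable P)
  (H : 'cV[R[i]]_np -> 'M[R[i]]_(no, ni))
  (H_L2 : mx_L2 mu P H)
  (alpha : 'I_qA -> 'cV[R[i]]_np -> R[i])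
  (beta : 'I_qB -> 'cV[R[i]]_np -> R[i])
  (gamma : 'I_qC -> 'cV[R[i]]_np -> R[i])
  (alpha_meas : forall i, cmeasurable (T := g_sigma_algebraType G) P (alpha i))
  (beta_meas : forall j, cmeasurable (T := g_sigma_algebraType G) P (beta j))
  (gamma_meas : forall k, cmeasurable (T := g_sigma_algebraType G) P (gamma k))
  (coeff_L2 :
    (\int[mu]_(p in P)
       (((\sum_j cabs (beta j p)) * (\sum_k cabs (gamma k p))
         / (\sum_i cabs (alpha i p))) ^+ 2)%:E < +oo)%E)
  (S : structured_rom R no ni r qA qB qC)
  (S_opt : L2_optimal mu P alpha beta gamma H (Sigma_DSt mu mP alpha) S)
  (l : 'I_r) :
  let Hh := Hhat alpha beta gamma S in
  let a := diag_a alpha S l in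
  let b := col_b beta S l in
  let c := col_c gamma S l in
  [/\ forall k : 'I_qC,
        eq_mx_integral mu P
          (fun p => ((gamma k p)^* / (a p)^*) *: (H p *m b p))
          (fun p => ((gamma k p)^* / (a p)^*) *: (Hh p *m b p)),
      forall j : 'I_qB,
        eq_mx_integral mu P
          (fun p => ((beta j p)^* / (a p)^*) *: ((c p)^t* *m H p))
          (fun p => ((beta j p)^* / (a p)^*) *: ((c p)^t* *m Hh p)) &
      forall i : 'I_qA,
        eq_mx_integral mu P
          (fun p => ((alpha i p)^* / (a p)^* ^+ 2) *: ((c p)^t* *m H p *m b p))
          (fun p => ((alpha i p)^* / (a p)^* ^+ 2) *: ((c p)^t* *m Hh p *m b p))].
Proof.
move=> Hh a b c.
have bE p n : b p n ord0 = (calB beta S p l n)^* by rewrite !mxE.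
have cE p m : ((c p)^t* ) ord0 m = (calC gamma S p m l)^* by rewrite !mxE.
have stC := stationary_C alpha_meas beta_meas gamma_meas coeff_L2 H_L2 S_opt.
have stB := stationary_B alpha_meas beta_meas gamma_meas coeff_L2 H_L2 S_opt.
have stA := stationary_A alpha_meas beta_meas gamma_meas coeff_L2 H_L2 S_opt.
have pairing :=
  eq_mx_integral_pairing alpha_meas beta_meas gamma_meas coeff_L2 H_L2 S_opt.
split=> [k|j|i].
- apply: (pairing _ _ (fun p X => ((gamma k p)^* / (a p)^*) *: (X *m b p))).
  move=> m o; rewrite (ord1 o); eexists; first exact: (stC k m l).
  move=> p X; rewrite (bigD1 m)//= [X in _ = _ + X]big1 ?addr0; last first.
    move=> m' /negPf m'm; rewrite big1// => n _.
    by rewrite mxE m'm mul0r rmorph0 mul0r.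
  rewrite [LHS]mxE [(X *m b p) _ _]mxE mulr_sumr; apply: eq_bigr => n _.
  rewrite bE [X in _ = X^* * _]mxE eqxx mul1r !rmorphM fmorphV/= -/(a p); ring.
- apply: (pairing _ _ (fun p X => ((beta j p)^* / (a p)^*) *: ((c p)^t* *m X))).
  move=> o n; rewrite (ord1 o); eexists; first exact: (stB j n l).
  move=> p X; rewrite [LHS]mxE [(_ *m X) _ _]mxE mulr_sumr.
  apply: eq_bigr => m _.
  rewrite (bigD1 n)//= [X in _ = _ + X]big1 ?addr0; last first.
    by move=> n' /negPf n'n; rewrite mxE n'n mul0r rmorph0 mul0r.
  rewrite cE [X in _ = X^* * _]mxE eqxx mul1r !rmorphM fmorphV/=.
  rewrite -/(a p); ring.
- apply: (pairing _ _ (fun p X =>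
    ((alpha i p)^* / (a p)^* ^+ 2) *: ((c p)^t* *m X *m b p))).
  move=> o o'; rewrite (ord1 o) (ord1 o'); eexists; first exact: (stA i l).
  move=> p X; rewrite [LHS]mxE [(_ *m b p) _ _]mxE mulr_sumr exchange_big/=.
  apply: eq_bigr => n _; rewrite bE [(_ *m X) _ _]mxE mulr_suml mulr_sumr.
  apply: eq_bigr => m _.
  rewrite cE [X in _ = X^* * _]mxE !rmorphM !fmorphV/=.
  rewrite -/(a p) -exprVn; ring.
Qed.
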